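(* Let $(G_k^\omega)_{k\in\mathbb{N}}\in\mathcal{G}^\omega$. If $Y$ is a Banach space admitting an equivalent asymptotically midpoint uniformly convex norm, then $\sup_{k\in\mathbb{N}}c_Y(G_k^\omega)=\infty$. In particular, if the equivalent asymptotically midpoint uniformly convex norm has power type $p\in(1,\infty)$, then $c_Y(G_k^\omega)\gtrsim k^{1/p}$, where $\gtrsim$ denotes the inequality $\ge$ up to a universal constant factor.
   Context: Distortion: for metric spaces $(X,d_X)$, $(Y,d_Y)$, $c_Y(X)$ is the infimum of all $D\ge 1$ for which there are $s>0$ and $f\colon X\to Y$ with $s\,d_X(x,y)\le d_Y(f(x),f(y))\le D s\,d_X(x,y)$ for all $x,y\in X$ (and $c_Y(X)=\infty$ if there is none). Asymptotic midpoint uniform convexity: for $t\in(0,1)$, $\tilde\delta_Y(t):=\inf_{y\in S_Y}\sup_{Z\in\mathrm{cof}(Y)}\inf_{z\in S_Z}\max\{\|y+tz\|,\|y-tz\|\}-1$, where $\mathrm{cof}(Y)$ is the set of (closed) finite-codimensional subspaces of $Y$ and $S_Z$ is the unit sphere of $Z$. The norm of $Y$ is asymptotically midpoint uniformly convex if $\tilde\delta_Y(t)>0$ for every $t\in(0,1)$; it has power type $p$ if there is $\gamma>0$ with $\tilde\delta_Y(t)\ge\gamma t^p$ for all $t\in(0,1)$. Graphs: all graphs are simple and carry the shortest path metric (edges, whatever their orientation, have length one). A bundle with finite height is a (possibly infinite) connected graph $G$ with two distinguished vertices $s=s(G)$ and $t=t(G)$ such that all simple $s$-$t$ paths have equal finite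 length; the distance $h(G)=d_G(s,t)$ is called the height. Bundles with finite height are understood to have the property that $d_G(s,x)+d_G(x,t)=d_G(s,t)=h(G)$ for every vertex $x$ of $G$. $\oslash$-product: for directed graphs $H,G$ with distinguished vertices $s,t$, $H\oslash G$ is obtained from $H$ by replacing each directed edge $e=(u,v)$ of $H$ by a separate copy of $G$, with $s(G)$ identified with $u$ and $t(G)$ identified with $v$; thus $V(H\oslash G)=V(H)\cup\big(E(H)\times(V(G)\setminus\{s(G),t(G)\})\big)$, the edges inherit the directions from $G$, and $s(H\oslash G)=s(H)$, $t(H\oslash G)=t(H)$. $\mathcal{G}^\omega$ is the family of all sequences of graphs $(G_k^\omega)_{k\in\mathbb{N}}$ such that the base graph $G_1^\omega$ is a directed graph which is an infinite bundle with finite height, and $G_{k+1}^\omega=G_k^\omega\oslash G_1^\omega$ for $k\ge1$. *)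

(* Defs.v *)
From HB Require Import structures.
From mathcomp Require Import all_boot all_order all_algebra.
From mathcomp Require Import all_classical all_reals all_analysis.
Set Implicit Arguments.
Unset Strict Implicit.
Unset Printing Implicit Defensive.
Import Order.TTheory GRing.Theory Num.Theory.
Import numFieldNormedType.Exports.

Local Open Scope classical_set_scope.
Local Open Scope ring_scope.

Record stdigraph := STDigraph {
  vertex :> eqType;
  edge : rel vertex;
  src : vertex;
  tgt : vertex }.

(* The underlying undirected graph is simple: no loops and at most one
   orientation per edge (asymmetry subsumes irreflexivity). *)
Definition simple_digraph (G : stdigraph) : Prop :=
  forall u v : G, edge u v -> ~~ edge v u.

Definition adj (G : stdigraph) : rel G := [rel u v | edge u v || edge v u].

(* As usual with [path], a walk from [x] is the list of its vertices after
   [x], so that its length is the size of that list. *)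
Definition walk (G : stdigraph) (x y : G) (p : seq G) : Prop :=
  path (@adj G) x p /\ last x p = y.

Definition simple_path (G : stdigraph) (x y : G) (p : seq G) : Prop :=
  walk x y p /\ uniq (x :: p).

Definition connected_graph (G : stdigraph) : Prop :=
  forall x y : G, exists p, walk x y p.

Definition walk_length (G : stdigraph) (x y : G) : pred nat :=
  fun n => `[< exists2 p, walk x y p & size p = n >].

(* Shortest path distance; the value 0 for vertices in different components
   is a dummy, only connected graphs being considered. *)
Definition gdist (G : stdigraph) (x y : G) : nat :=
  match pselect (exists n, walk_length x y n) with
  | left ex => ex_minn ex
  | right _ => 0%N
  end.

Definition height (G : stdigraph) : nat := gdist (src G) (tgt G).

(* The orientation of the edges is arbitrary. *)
Definition bundle_with_finite_height (G : stdigraph) : Prop :=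
  [/\ simple_digraph G,
      connected_graph G,
      exists n : nat, forall p, simple_path (src G) (tgt G) p -> size p = n
    & forall x : G, (gdist (src G) x + gdist x (tgt G))%N = height G].

Definition infinite_graph (G : stdigraph) : Prop := infinite_set [set: G].

Section oslash.
Variables H G : stdigraph.

Definition dedge := {e : H * H | edge e.1 e.2}.

Definition inner := {x : G | (x != src G) && (x != tgt G)}.

Definition oslash_vertex : eqType := (H + dedge * inner)%type.

(* Inclusion in oslash H G of the copy of G that replaces e = (u, v). *)
Definition copy (e : dedge) (x : G) : oslash_vertex :=
  match insub x : option inner with
  | Some i => inr (e, i)
  | None => inl (if x == src G then (val e).1 else (val e).2)
  end.

Definition oslash_edge : rel oslash_vertex := fun a b =>
  `[< exists e : dedge, exists x y : G,
        [/\ edge x y, a = copy e x & b = copy e y] >].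

Definition oslash : stdigraph :=
  STDigraph oslash_edge (inl (src H)) (inl (tgt H)).

End oslash.

(* Membership of (G_k), k >= 1, in the family G^omega; [G 0] plays no role. *)
Definition omega_family (G : nat -> stdigraph) : Prop :=
  [/\ bundle_with_finite_height (G 1%N),
      infinite_graph (G 1%N)
    & forall k, (1 <= k)%N -> G k.+1 = oslash (G k) (G 1%N)].

(* c_Y(X); the infimum of the empty set is +oo. *)
Definition distortion (R : realType) (X Y : Type)
    (dX : X -> X -> R) (dY : Y -> Y -> R) : \bar R :=
  ereal_inf [set D%:E | D in [set D : R | 1 <= D /\
    exists s : R, exists f : X -> Y, 0 < s /\
      forall x y, s * dX x y <= dY (f x) (f y) <= D * s * dX x y]].

Definition graph_distortion (R : realType) (Y : normedModType R)
    (G : stdigraph) : \bar R :=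
  distortion (fun x y : G => (gdist x y)%:R : R) (fun x y : Y => `|x - y|).

Section renorming.
Context {R : realType} {Y : normedModType R}.

Definition is_norm (N : Y -> R) : Prop :=
  [/\ forall x y, N (x + y) <= N x + N y,
      forall (a : R) x, N (a *: x) = `|a| * N x
    & forall x, N x = 0 -> x = 0].

Definition equivalent_norm (N : Y -> R) : Prop :=
  is_norm N /\
  exists A B : R, [/\ 0 < A, 0 < B & forall x, A * `|x| <= N x <= B * `|x|].

Definition cof : set (set Y) := [set Z | [/\ closed Z,
  Z 0,
  forall (a : R) (u v : Y), Z u -> Z v -> Z (a *: u + v) &
  exists n (e : 'I_n -> Y), forall y, exists2 z : Y, Z z &
    exists a : 'I_n -> R, y = z + \sum_(i < n) a i *: e i]].

Definition sphere_in (N : Y -> R) (Z : set Y) : set Y :=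
  [set z | Z z /\ N z = 1].

Definition midpoint_max (N : Y -> R) (t : R) (y z : Y) : R :=
  Num.max (N (y + t *: z)) (N (y - t *: z)).

(* Modulus of asymptotic midpoint uniform convexity of the norm N. *)
Definition amuc_modulus (N : Y -> R) (t : R) : \bar R :=
  (ereal_inf [set
     ereal_sup [set
       ereal_inf [set (midpoint_max N t y z)%:E | z in sphere_in N Z]
       | Z in cof]
     | y in sphere_in N setT] - 1)%E.

Definition amuc (N : Y -> R) : Prop :=
  forall t : R, 0 < t < 1 -> (0 < amuc_modulus N t)%E.

Definition amuc_power_type (N : Y -> R) (p : R) : Prop :=
  exists2 gamma : R, 0 < gamma &
    forall t : R, 0 < t < 1 -> ((gamma * t `^ p)%:E <= amuc_modulus N t)%E.

End renorming.

(* Main.v *)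
Require Import Defs.
From mathcomp Require Import all_boot all_order all_algebra.
From mathcomp Require Import all_classical all_reals all_analysis.
From mathcomp Require Import ring lra zify.
Import Order.TTheory GRing.Theory Num.Theory.
Import numFieldNormedType.Exports.
Set Implicit Arguments.
Unset Strict Implicit.
Unset Printing Implicit Defensive.
Local Open Scope classical_set_scope.
Local Open Scope ring_scope.

(* Some level strictly between s and t of the base graph G_1 of height h
   contains infinitely many vertices. Let f embed G_{k+1} = G_k \oslash G_1
   with |f x - f y| >= d(x, y), and with |f x - f y| <= D on edges. In the copy
   of G_1 over an edge (u, v) of G_k, the infinitely many vertices of that level
   are 1-separated and act as approximate metric midpoints of f u and f v. Their
   images are bounded, so two of them differ, up to a small error, by an element
   of any prescribed finite-codimensional subspace; the midpoint modulus then
   forces |f u - f v| <= h D / (1 + eta) with eta of the order of the modulus at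
   1 / (4 h D). Since distances in G_k are multiplied by h in G_{k+1}, f / h is
   an embedding of G_k with the same lower bound and with D replaced by
   D / (1 + eta), and one iterates down to G_1, where still D >= 1. *)

(** * Walks and distances in graphs *)

Section graphs.
Implicit Types G H : stdigraph.

Lemma walk_cat G (x y z : G) p q :
  walk x y p -> walk y z q -> walk x z (p ++ q).
Proof.
by move=> [xp <-] [yq <-]; split; rewrite ?last_cat// cat_path xp.
Qed.

Lemma gdist_le G (x y : G) p : walk x y p -> (gdist x y <= size p)%N.
Proof.
move=> xyp; have Lp : walk_length x y (size p) by apply/asboolP; exists p.
rewrite /gdist; case: pselect => [ex|[]]; last by exists (size p).
by case: ex_minnP => m _; apply.
Qed.

Lemma gdist_walk G (x y : G) : connected_graph G ->
  exists2 p, walk x y p & size p = gdist x y.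
Proof.
move=> /(_ x y)[q xyq]; rewrite /gdist; case: pselect => [ex|[]].
  by case: ex_minnP => m /asboolP.
by exists (size q); apply/asboolP; exists q.
Qed.

Lemma gdistxx G (x : G) : gdist x x = 0%N.
Proof. by apply/eqP; rewrite -leqn0; apply: (@gdist_le _ _ _ [::]). Qed.

Lemma gdist_eq0 G (x y : G) : connected_graph G -> gdist x y = 0%N -> x = y.
Proof. by move=> cG; have [[|z p] [_ /= xy] <-] := gdist_walk x y cG. Qed.

Lemma adj_sym G : symmetric (@adj G).
Proof. by move=> x y; rewrite /adj /= orbC. Qed.

Lemma gdist_adj G (x y z : G) : connected_graph G -> adj y z ->
  (gdist x z <= (gdist x y).+1)%N.
Proof.
move=> cG yz; have [p xyp <-] := gdist_walk x y cG.
rewrite -addn1 -[1%N]/(size [:: z]) -size_cat; apply: gdist_le.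
by apply: walk_cat xyp _; split=> //=; rewrite yz.
Qed.

(** A single walk bounds a distance only from above. A function growing by at most one along every
    edge bounds all walks at once, hence the distance from below. *)
Lemma potential_walk G (phi : G -> nat) (x y : G) p :
    (forall a b : G, adj a b -> (phi b <= (phi a).+1)%N) ->
  walk x y p -> (phi y <= phi x + size p)%N.
Proof.
move=> phi1 [xp <-]; elim: p x xp => [|z p IHp] x /=; first by rewrite addn0.
move=> /andP[/phi1 zx /IHp]; lia.
Qed.

(** * Connectedness and distances of the product *)

Section oslash.
Variables H G : stdigraph.
Hypothesis st : src G != tgt G.
Implicit Types (e : dedge H) (x y : G).

Lemma copy_src e : copy e (src G) = inl (val e).1 :> oslash H G.
Proof. by rewrite /copy insubF ?eqxx. Qed.

Lemma copy_tgt e : copy e (tgt G) = inl (val e).2 :> oslash H G.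
Proof. by rewrite /copy insubF ?eqxx ?andbF// eq_sym (negPf st). Qed.

Lemma copy_inner e (i : inner G) : copy e (val i) = inr (e, i) :> oslash H G.
Proof. by rewrite /copy valK. Qed.

(** Inner vertices go to the right summand, which records them, and the two ends to the left one; so
    it is enough that [x] is inner. *)
Lemma copy_inj e x y : x != src G -> x != tgt G ->
  copy e x = copy e y -> x = y.
Proof.
move=> xs xt; have xi : (x != src G) && (x != tgt G) by rewrite xs.
rewrite /copy (insubT (fun x => (x != src G) && (x != tgt G)) xi).
by case: insubP => // i _ <- [<-].
Qed.

Lemma copy_adj e x y : adj x y ->
  @adj (oslash H G) (copy e x) (copy e y).
Proof.
by case/orP=> xy; apply/orP; [left|right]; apply/asboolP; exists e;
  [exists x, y|exists y, x].
Qed.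

Lemma copy_walk e x y p : walk x y p ->
  @walk (oslash H G) (copy e x) (copy e y) (map (copy e) p).
Proof.
move=> [xp <-]; split; last by rewrite last_map.
by rewrite path_map; apply: sub_path xp => a b; apply: copy_adj.
Qed.

Lemma connected_oslash : connected_graph H -> connected_graph G ->
  connected_graph (oslash H G).
Proof.
move=> cH cG.
have cc e x y : exists p, @walk (oslash H G) (copy e x) (copy e y) p.
  by have [p /(copy_walk e) xyp] := cG x y; eexists; exact: xyp.
have trans (a b c : oslash H G) : (exists p, walk a b p) ->
    (exists p, walk b c p) -> exists p, walk a c p.
  by move=> [p abp] [q bcq]; exists (p ++ q); apply: walk_cat bcq.
(* A walk in [H] is lifted edge by edge; an edge run against its orientation becomes a walk from
   [tgt G] to [src G]. *)
have cHH (u v : H) : exists p, @walk (oslash H G) (inl u) (inl v) p.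
  have [p [up <-]] := cH u v; elim: p u up => [|w p IHp] u /=.
    by exists [::].
  move=> /andP[uw /IHp]; apply: trans.
  case/orP: uw => uw.
    pose e : dedge H := Sub (u, w) uw.
    by have := cc e (src G) (tgt G); rewrite copy_src copy_tgt.
  pose e : dedge H := Sub (w, u) uw.
  by have := cc e (tgt G) (src G); rewrite copy_src copy_tgt.
have toH (a : oslash H G) : exists u : H,
    (exists p, walk a (inl u : oslash H G) p) /\
    (exists p, walk (inl u : oslash H G) a p).
  case: a => [u|[e i]]; first by exists u; split; exists [::].
  by exists (val e).1; rewrite -copy_src -(copy_inner e i); split; apply: cc.
move=> a b; have [u [au _]] := toH a; have [v [_ vb]] := toH b.
exact: trans (trans _ _ _ au (cHH u v)) vb.
Qed.

(* The distance to [inl u] in [oslash H G] is the length of the shorter of the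
   two ways of leaving the copy through its ends. *)
Lemma gdist_oslash (u v : H) :
  connected_graph H -> bundle_with_finite_height G ->
  (height G * gdist u v <= @gdist (oslash H G) (inl u) (inl v))%N.
Proof.
move=> cH [_ cG _ Gh]; set h := height G.
(* By the bundle identity [h - gdist (src G) x] is the distance from [x] to [tgt G]. *)
pose d e x := minn (h * gdist u (val e).1 + gdist (src G) x)
                   (h * gdist u (val e).2 + (h - gdist (src G) x)).
pose phi (a : oslash H G) : nat := match a with
  | inl w => (h * gdist u w)%N
  | inr (e, i) => d e (val i) end.
have du e : (gdist u (val e).1 <= (gdist u (val e).2).+1)%N /\
            (gdist u (val e).2 <= (gdist u (val e).1).+1)%N.
  have ad : adj (val e).1 (val e).2 by rewrite /adj /= (valP e).
  by split; apply: gdist_adj; rewrite // adj_sym.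
(* Copies are glued at their ends, so [d e] must agree there with [phi] on [H]. It does: [gdist u]
   changes by at most one along [e], while crossing the copy costs [h]. *)
have phi_copy e x : phi (copy e x) = d e x.
  have [->|xs] := eqVneq x (src G).
    rewrite copy_src /phi /d gdistxx subn0 addn0 addnC -mulnS.
    by apply/esym/minn_idPl; rewrite leq_mul2l (du e).1 orbT.
  have [->|xt] := eqVneq x (tgt G).
    rewrite copy_tgt /phi /d -/(height G) subnn addn0 addnC -mulnS.
    by apply/esym/minn_idPr; rewrite leq_mul2l (du e).2 orbT.
  have xi : (x != src G) && (x != tgt G) by rewrite xs.
  by rewrite -[x]/(val (Sub x xi : inner G)) copy_inner.
have [p ap <-] := gdist_walk (inl u : oslash H G) (inl v)
  (connected_oslash cH cG).
have dS e x y : adj x y -> (d e y <= (d e x).+1)%N.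
  move=> xy; rewrite /d; have yx : adj y x by rewrite adj_sym.
  have := gdist_adj (src G) cG xy; have := gdist_adj (src G) cG yx; lia.
have phi1 (a b : oslash H G) : adj a b -> (phi b <= (phi a).+1)%N.
  move=> /orP[] /asboolP[e [x [y [xy -> ->]]]]; rewrite !phi_copy; apply: dS;
    by rewrite /adj /= xy ?orbT.
by have := potential_walk phi1 ap; rewrite /phi gdistxx muln0 add0n.
Qed.

End oslash.

(** * An infinite level of the base graph *)

Lemma infinite_fiber (T : Type) (X : set T) (g : T -> nat) (n : nat) :
    infinite_set X -> (forall x, X x -> (g x < n)%N) ->
  exists2 i, (i < n)%N & infinite_set (X `&` g @^-1` [set i]).
Proof.
move=> Xinf gn; apply: contrapT => nfib; apply: Xinf.
apply: (@sub_finite_set _ _ (\bigcup_(i in `I_n) (X `&` g @^-1` [set i]))).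
  by move=> x Xx; exists (g x); [exact: gn|].
apply: bigcup_finite; first exact: finite_II.
by move=> i ni; apply: contrapT => nfin; apply: nfib; exists i.
Qed.

(** The bundle identity leaves only the levels 0 to [height G], one of which is infinite by
    pigeonhole; the two extreme ones consist of a single end. *)
Lemma infinite_level G : bundle_with_finite_height G -> infinite_graph G ->
  exists2 j, (0 < j < height G)%N &
    infinite_set [set x : G | gdist (src G) x = j].
Proof.
move=> [_ cG _ Gh] /(@infinite_fiber _ _ (gdist (src G)) (height G).+1)[x _|].
  by rewrite ltnS -(Gh x) leq_addr.
move=> j jh; rewrite setTI => jinf; exists j; last exact: jinf.
have [j0|j0] := posnP j.
  exfalso; apply: jinf; apply: sub_finite_set (finite_set1 (src G)).
  by move=> x /=; rewrite j0 => /gdist_eq0 <-.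
rewrite /= ltn_neqAle -ltnS jh andbT; apply/eqP => je.
apply: jinf; apply: sub_finite_set (finite_set1 (tgt G)).
move=> x /= xj; apply: gdist_eq0 => //.
by apply/eqP; rewrite -(eqn_add2l (gdist (src G) x)) Gh xj je addn0.
Qed.

End graphs.

(** * Bounded families modulo a finite-codimensional subspace *)

Section clusters.
Context {R : realType} {T : Type}.

(** Pigeonhole on cells of length [tau] covering the interval from [-M] to [M]; the shift by [M]
    makes the truncated quotients nonnegative. *)
Lemma bounded_cluster (X : set T) (a : T -> R) (M tau : R) :
    infinite_set X -> 0 < tau -> (forall x, X x -> `|a x| <= M) ->
  exists2 X' : set T, X' `<=` X & infinite_set X' /\
    forall x x', X' x -> X' x' -> `|a x - a x'| <= tau.
Proof.
move=> Xinf tau0 aM; pose b x := (a x + M) / tau.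
have b0 x : X x -> 0 <= b x.
  by move=> /aM; rewrite ler_norml => ?; rewrite divr_ge0 ?(ltW tau0)//; lra.
have [|i _ iinf] := @infinite_fiber _ X (Num.trunc \o b)
    (Num.trunc ((M + M) / tau)).+1 Xinf.
  move=> x Xx /=; rewrite ltnS le_truncn// ler_pM2r ?invr_gt0//.
  by have := aM _ Xx; rewrite ler_norml; lra.
exists (X `&` (Num.trunc \o b) @^-1` [set i]); first by move=> x [].
split=> // x x' [Xx /= xi] [Xx' /= x'i].
have := truncn_itv (b0 _ Xx); have := truncn_itv (b0 _ Xx').
rewrite xi x'i -natr1 /b !ler_pdivlMr// !ltr_pdivrMr// => /andP[? ?] /andP[? ?].
by rewrite ler_norml; apply/andP; split; lra.
Qed.

(** Modulo [Z] the points [w x] form a bounded set in finite dimension. The induction adds [e0] to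
    [Z], and then removes the multiple of [e0] that this leaves in the differences. *)
Lemma finite_codim_cluster {Y : normedModType R} n (Z : set Y) (e : 'I_n -> Y)
    (X : set T) (w : T -> Y) (M tau : R) :
    Z 0 -> (forall (a : R) u v, Z u -> Z v -> Z (a *: u + v)) ->
    (forall y, exists2 z, Z z &
      exists a : 'I_n -> R, y = z + \sum_(i < n) a i *: e i) ->
    infinite_set X -> 0 < tau -> (forall x, X x -> `|w x| <= M) ->
  exists2 X' : set T, X' `<=` X & infinite_set X' /\
    forall x x', X' x -> X' x' -> exists2 z, Z z & `|w x - w x' - z| <= tau.
Proof.
elim: n Z e X tau => [|n IHn] Z e X tau Z0 Zlin Zspan Xinf tau0 wM.
  exists X => //; split=> // x x' _ _; exists (w x - w x').
    have [z Zz [a ->]] := Zspan (w x - w x'); by rewrite big_ord0 addr0.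
  by rewrite subrr normr0 ltW.
pose e0 := e ord0.
pose Z' := [set y | exists2 z, Z z & exists a : R, y = z + a *: e0].
have ZB u v : Z u -> Z v -> Z (u - v).
  by move=> Zu Zv; rewrite addrC -scaleN1r; apply: Zlin.
(* The multiple of [e0] will cost [tau / 2], and the error from the induction enters at most
   twice. *)
have t4 : 0 < tau / 4%:R by lra.
have [||y|X1 X1X [X1inf X1P]] :=
    IHn Z' (fun i => e (lift ord0 i)) X (tau / 4%:R) _ _ _ Xinf t4 wM.
- by exists 0 => //; exists 0; rewrite scale0r addr0.
- move=> a _ _ [u Zu [b ->]] [v Zv [c ->]].
  exists (a *: u + v); first exact: Zlin.
  by exists (a * b + c); rewrite scalerDl scalerDr scalerA addrACA.
- have [z Zz [a ->]] := Zspan y; exists (z + a ord0 *: e0).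
    by exists z => //; exists (a ord0).
  by exists (a \o lift ord0); rewrite big_ord_recl addrA.
(* If [e0] is a limit of points of [Z], each multiple of [e0] is replaced by one of a nearby point
   of [Z]. If it stays at distance [d] from [Z], its coefficients are bounded and can be
   clustered. *)
have [[d d0 dP]|e0Z] := pselect (exists2 d, 0 < d &
    forall z, Z z -> d <= `|e0 - z|); last first.
  exists X1 => //; split=> // x x' Xx Xx'.
  have [_ [z Zz [a ->]] ztau] := X1P _ _ Xx Xx'.
  pose eps := tau / (2%:R * (`|a| + 1)).
  have eps0 : 0 < eps by rewrite divr_gt0// mulr_gt0// ltr_wpDl.
  have [z1 Zz1 z1e] : exists2 z1, Z z1 & `|e0 - z1| <= eps.
    apply: contrapT => nz1; apply: e0Z; exists eps => // z1 Zz1.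
    by apply: contra_notT nz1; rewrite -ltNge => /ltW; exists z1.
  exists (a *: z1 + z); first exact: Zlin.
  have -> : w x - w x' - (a *: z1 + z) =
      (w x - w x' - (z + a *: e0)) + a *: (e0 - z1).
    by rewrite scalerBr !opprD !addrA subrK [LHS](ACl (1*2*4*3)).
  apply: le_trans (ler_normD _ _) _; rewrite normrZ.
  have : `|a| * `|e0 - z1| <= tau / 2%:R.
    apply: le_trans (_ : (`|a| + 1) * eps <= _).
      by apply: ler_pM => //; rewrite lerDl.
    suff -> : (`|a| + 1) * eps = tau / 2%:R by [].
    by rewrite /eps; field; rewrite gt_eqF// ltr_wpDl.
  by lra.
have [x0 X1x0] : X1 !=set0 by apply: infinite_setN0.
have /choice[a aP] x : exists a : R, X1 x -> exists2 z, Z z &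
    `|w x - w x0 - (z + a *: e0)| <= tau / 4%:R.
  have [Xx|] := pselect (X1 x); last by exists 0.
  by have [_ [z Zz [a ->]] ztau] := X1P _ _ Xx X1x0; exists a => _; exists z.
(* For [a x != 0], the vector [z + a x *: e0] is [a x] times the difference of [e0] and a point of
   [Z], so its norm is at least [|a x| * d]. *)
have aM x : X1 x -> `|a x| <= (M + M + tau / 4%:R) / d.
  move=> Xx; have [z Zz ztau] := aP _ Xx.
  have [->|a0] := eqVneq (a x) 0.
    rewrite normr0 divr_ge0 ?(ltW d0)//; have := wM _ (X1X _ Xx).
    by have := normr_ge0 (w x); lra.
  have /dP : Z (- (a x)^-1 *: z + 0) by apply: Zlin.
  rewrite addr0 scaleNr opprK -(ler_pM2l (_ : 0 < `|a x|)) ?normr_gt0//.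
  rewrite -normrZ scalerDr scalerA mulfV// scale1r => ad.
  rewrite ler_pdivlMr//; apply: le_trans ad _; rewrite addrC.
  rewrite -[z + _](subKr (w x - w x0)).
  apply: le_trans (ler_normB _ _) _; apply: lerD => //.
  by apply: le_trans (ler_normB _ _) _; apply: lerD; apply: wM; apply: X1X.
pose eps := tau / (2%:R * (`|e0| + 1)).
have eps0 : 0 < eps by rewrite divr_gt0// mulr_gt0// ltr_wpDl.
have [X2 X21 [X2inf X2P]] := bounded_cluster X1inf eps0 aM.
exists X2; first exact: subset_trans X1X.
split=> // x x' Xx Xx'.
have [z Zz zt] := aP _ (X21 _ Xx); have [z' Zz' zt'] := aP _ (X21 _ Xx').
exists (z - z'); first exact: ZB.
have -> : w x - w x' - (z - z') = (w x - w x0 - (z + a x *: e0))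
    - (w x' - w x0 - (z' + a x' *: e0)) + (a x - a x') *: e0.
  rewrite scalerBl !(opprD, opprK) !addrA.
  rewrite [RHS](ACl (1*5*3*7*(2*6)*(4*9)*(8*10))) /=.
  by rewrite addNr addNr subrr !addr0.
apply: le_trans (ler_normD _ _) _; rewrite normrZ.
have : `|a x - a x'| * `|e0| <= tau / 2%:R.
  apply: le_trans (_ : eps * (`|e0| + 1) <= _).
    by apply: ler_pM => //; [exact: X2P|rewrite lerDl].
  suff -> : eps * (`|e0| + 1) = tau / 2%:R by [].
  by rewrite /eps; field; rewrite gt_eqF// ltr_wpDl.
have := ler_normB (w x - w x0 - (z + a x *: e0))
  (w x' - w x0 - (z' + a x' *: e0)).
by lra.
Qed.

End clusters.

(** * Equivalent norms and the midpoint modulus *)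

Section norms.
Context {R : realType} {Y : normedModType R}.
Variable N : Y -> R.
Hypothesis normN : is_norm N.

Lemma is_norm0 : N 0 = 0.
Proof. by have [_ NZ _] := normN; rewrite -(scale0r 0) NZ normr0 mul0r. Qed.

Lemma is_normN x : N (- x) = N x.
Proof. by have [_ NZ _] := normN; rewrite -scaleN1r NZ normrN1 mul1r. Qed.

Lemma is_normB x y : N (x - y) <= N x + N y.
Proof. by have [ND _ _] := normN; rewrite -(is_normN y). Qed.

Lemma is_norm_distC x y : N (x - y) = N (y - x).
Proof. by rewrite -is_normN opprB. Qed.

Lemma is_norm_ge0 x : 0 <= N x.
Proof. by have := is_normB x x; rewrite subrr is_norm0; lra. Qed.

(** The point lies on the segment from [y] to [y + v]; this shortens an increment to the length at
    which the modulus is evaluated. *)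
Lemma is_norm_convex (K c : R) y v : 0 <= c <= 1 ->
  N y <= K -> N (y + v) <= K -> N (y + c *: v) <= K.
Proof.
have [ND NZ _] := normN => /andP[c0 c1] yK yvK.
have -> : y + c *: v = (1 - c) *: y + c *: (y + v).
  by rewrite scalerBl scale1r scalerDr addrA subrK.
apply: le_trans (ND _ _) _; rewrite !NZ !ger0_norm ?subr_ge0//.
have -> : K = (1 - c) * K + c * K by ring.
by apply: lerD; apply: ler_wpM2l; rewrite ?subr_ge0.
Qed.

Lemma amuc_modulus_gt (t eta : R) (y : Y) :
  (eta%:E < amuc_modulus N t)%E -> N y = 1 ->
  exists2 Z, cof Z & forall z, Z z -> N z = 1 -> 1 + eta < midpoint_max N t y z.
Proof.
rewrite /amuc_modulus lteBrDr// => lt_eta y1.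
have /ereal_sup_gt[_ [Z cofZ <-] ltZ] :=
  lt_le_trans lt_eta (ereal_inf_lbound (imageP _ (conj I y1))).
exists Z => // z Zz z1; rewrite addrC -lte_fin EFinD.
exact: lt_le_trans ltZ (ereal_inf_lbound (imageP _ (conj Zz z1))).
Qed.

Lemma scale_half (x : Y) : 2%:R^-1 *: (x + x) = x :> Y.
Proof. by rewrite scalerDr -scalerDl -[RHS]scale1r; congr (_ *: _); field. Qed.

(* A difference of two of the [v x] lies near a given finite-codimensional
   subspace, and half of it is, by convexity, nearly as good as the [v x]. *)
Lemma amuc_spread {T : Type} (X : set T) (v : T -> Y) (y : Y) (t eta L r : R) :
    equivalent_norm N -> 0 < t < 1 -> 0 <= eta ->
    (eta%:E < amuc_modulus N t)%E ->
    infinite_set X ->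
    (forall x, X x -> N (y + v x) <= L) ->
    (forall x, X x -> N (y - v x) <= L) ->
    (forall x x', X x -> X x' -> x <> x' -> r <= N (v x - v x')) ->
    0 < r -> t * (4%:R * L) <= r ->
  N y * (1 + eta) <= L.
Proof.
move=> [_ [A [B [A0 B0 NAB]]]] /andP[t0 _] eta0 lt_eta Xinf vL vNL vr r0 tLr.
have [ND NZ N0] := normN.
have half u : N (2%:R^-1 *: u) = 2%:R^-1 * N u by rewrite NZ ger0_norm.
have yL : N y <= L.
  have [x Xx] := infinite_setN0 Xinf.
  have -> : y = 2%:R^-1 *: ((y + v x) + (y - v x)).
    by rewrite addrACA subrr addr0 scale_half.
  by rewrite half; have := ND (y + v x) (y - v x); have := vL x Xx;
    have := vNL x Xx; lra.
have [y0|] := ltP 0 (N y); last first.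
  have := is_norm_ge0 y => ? ?.
  by have -> : N y = 0 by [lra]; lra.
have vM x : X x -> `|v x| <= L / A.
  move=> Xx; rewrite ler_pdivlMr// mulrC.
  apply: le_trans (_ : N (v x) <= _); first by have /andP[] := NAB (v x).
  have -> : v x = 2%:R^-1 *: ((y + v x) - (y - v x)).
    by rewrite opprB [y + v x]addrC addrACA subrr addr0 scale_half.
  by rewrite half; have := is_normB (y + v x) (y - v x); have := vL x Xx;
    have := vNL x Xx; lra.
pose y1 := (N y)^-1 *: y.
have [|Z [_ Z0 Zlin [n [e Zspan]]] Zeta] := amuc_modulus_gt (y := y1) lt_eta.
  by rewrite NZ gtr0_norm ?invr_gt0// mulVf// gt_eqF.
apply/ler_addgt0Pr => eps eps0.
(* Below [eps] the error vanishes in the limit; below [r / 2] it leaves [N z] at least [r / 2].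
   Dividing by [B] accounts for clustering in the original norm. *)
pose tau := Num.min eps (r / 2%:R).
have tau0 : 0 < tau by rewrite lt_min eps0 divr_gt0.
have taueps : tau <= eps by rewrite ge_min lexx.
have taur : tau <= r / 2%:R by rewrite ge_min lexx orbT.
have tauB : 0 < tau / B by rewrite divr_gt0.
have [X' X'X [X'inf X'P]] :=
  finite_codim_cluster Z0 Zlin Zspan Xinf tauB vM.
have [x X'x] := infinite_setN0 X'inf.
have [x' [X'x' xx']] : exists x', X' x' /\ x <> x'.
  apply: contrapT => all_x; apply: X'inf.
  apply: sub_finite_set (finite_set1 x) => x' X'x'.
  by apply: contrapT => xx'; apply: all_x; exists x'; split=> // /esym.
have [z Zz] := X'P _ _ X'x X'x'; set rho := v x - v x' - z => rhotau.
have Nrho : N rho <= tau.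
  have /andP[_ /le_trans] := NAB rho; apply.
  by rewrite mulrC -ler_pdivlMr.
have vz : v x - v x' = z + rho by rewrite /rho [RHS]addrC subrK.
pose s := 2%:R^-1 *: z; have Zs : Z s by rewrite /s -[_ *: _]addr0; apply: Zlin.
(* Up to half of [rho], [y + s] is the midpoint of [y + v x] and [y - v x']; [y - s] arises from the
   opposite signs. *)
have ysP : N (y + s) <= L + tau.
  have -> : y + s = 2%:R^-1 *: ((y + v x) + (y - v x')) - 2%:R^-1 *: rho.
    rewrite addrACA vz scalerDr scale_half.
    by rewrite scalerDr addrA addrK.
  apply: le_trans (is_normB _ _) _; rewrite !half.
  by have := ND (y + v x) (y - v x'); have := vL _ (X'X _ X'x);
    have := vNL _ (X'X _ X'x'); lra.
have ysN : N (y - s) <= L + tau.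
  have -> : y - s = 2%:R^-1 *: ((y - v x) + (y + v x')) + 2%:R^-1 *: rho.
    rewrite addrACA [- v x + v x']addrC -[v x' - v x]opprB vz.
    by rewrite scalerDr scale_half scalerN scalerDr opprD addrA subrK.
  apply: le_trans (ND _ _) _; rewrite !half.
  by have := ND (y - v x) (y + v x'); have := vNL _ (X'X _ X'x);
    have := vL _ (X'X _ X'x'); lra.
have sr : r / 4%:R <= N s.
  rewrite /s half; have := vr _ _ (X'X _ X'x) (X'X _ X'x') xx'.
  by rewrite vz; have := ND z rho; lra.
have s0 : 0 < N s by apply: lt_le_trans sr; rewrite divr_gt0.
(* This gives [c *: s] the norm [t * N y], so that after division by [N y] it is [t] times a unit
   vector of [Z]. *)
pose c := t * N y / N s.
have c01 : 0 <= c <= 1.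
  rewrite /c divr_ge0 ?mulr_ge0 ?(ltW t0) ?(ltW y0) ?(ltW s0)//=.
  rewrite ler_pdivrMr// mul1r; apply: le_trans sr.
  rewrite ler_pdivlMr// -mulrA; apply: le_trans tLr.
  by rewrite ler_pM2l// mulrC ler_pM2l.
pose s1 := (N s)^-1 *: s.
have Ns1 : N s1 = 1 by rewrite NZ gtr0_norm ?invr_gt0// mulVf// gt_eqF.
have Zs1 : Z s1 by rewrite /s1 -[_ *: _]addr0; apply: Zlin.
have ts1 : t *: s1 = (N y)^-1 *: (c *: s).
  by rewrite !scalerA /c; congr (_ *: _); field; rewrite !gt_eqF.
have := Zeta _ Zs1 Ns1; rewrite /midpoint_max lt_max ts1 /y1.
rewrite -scalerDr -scalerBr !NZ !gtr0_norm ?invr_gt0//.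
rewrite ![(N y)^-1 * _]mulrC !ltr_pdivlMr// -scalerN => /orP lt_y.
apply: le_trans (_ : L + tau <= _); last by rewrite lerD2l.
have yLt : N y <= L + tau by lra.
rewrite [N y * _]mulrC.
by case: lt_y => /ltW /le_trans; apply; apply: is_norm_convex.
Qed.

End norms.

(* Along walks, the bound on edges makes [f] D-Lipschitz. *)
Definition stretch {R : realType} {Y : normedModType R} (N : Y -> R)
    (G : stdigraph) (f : G -> Y) (D : R) : Prop :=
  (forall x y, (gdist x y)%:R <= N (f x - f y)) /\
  (forall x y, adj x y -> N (f x - f y) <= D).

(** * One descent step, from the product to its first factor *)

Section stretch.
Context {R : realType} {Y : normedModType R}.
Variable N : Y -> R.
Hypothesis eqN : equivalent_norm N.
Let normN : is_norm N. Proof. by case: eqN. Qed.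

Lemma stretch_walk (G : stdigraph) (f : G -> Y) (D : R) x y p :
  stretch N f D -> walk x y p -> N (f x - f y) <= D * (size p)%:R.
Proof.
move=> [_ fD] [xp <-]; elim: p x xp => [|z p IHp] x /=.
  by rewrite subrr is_norm0// mulr0.
move=> /andP[xz /IHp zp]; rewrite -natr1 mulrDr mulr1 -(subrKA (f z)).
have [ND _ _] := normN; apply: le_trans (ND _ _) _.
by rewrite addrC lerD// fD.
Qed.

(** A shortest walk between the ends compares a positive distance with [D] times itself. This floor
    is what ends the descent. *)
Lemma stretch_ge1 (G : stdigraph) (f : G -> Y) (D : R) :
  connected_graph G -> src G != tgt G -> stretch N f D -> 1 <= D.
Proof.
move=> cG st fD; have [p st_p hp] := gdist_walk (src G) (tgt G) cG.
have := le_trans (fD.1 _ _) (stretch_walk fD st_p).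
rewrite hp ler_pMl//.
by rewrite ltr0n lt0n; apply: contra_neq st; exact: gdist_eq0.
Qed.

Lemma stretch_oslash (H G : stdigraph) (f : oslash H G -> Y) (D t eta : R) :
    bundle_with_finite_height G -> infinite_graph G -> connected_graph H ->
    0 < t < 1 -> 0 <= eta -> (eta%:E < amuc_modulus N t)%E ->
    t * (4%:R * (height G)%:R * D) <= 1 -> stretch N f D ->
  exists f' : H -> Y, stretch N f' (D / (1 + eta)).
Proof.
move=> bG Ginf cH t01 eta0 lt_eta tD fD; have [_ cG _ Gh] := bG.
have [ND NZ _] := normN.
have [j /andP[j0 jh] jinf] := infinite_level bG Ginf.
have st : src G != tgt G.
  by apply: contraTneq jh => st; rewrite /height -st gdistxx -leqNgt.
set h : R := (height G)%:R; pose k : R := j%:R.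
have h0 : 0 < h by rewrite ltr0n (ltn_trans j0 jh).
have k0 : 0 < k by rewrite ltr0n.
have kh : k < h by rewrite ltr_nat.
have eta1 : 0 < 1 + eta by lra.
pose g (u : H) := f (inl u).
have NhZ x : N (h^-1 *: x) = N x / h by rewrite NZ gtr0_norm ?invr_gt0// mulrC.
exists (fun u => h^-1 *: g u); split=> [u v|].
  rewrite -scalerBr NhZ ler_pdivlMr// -natrM mulnC.
  apply: le_trans (fD.1 _ _); rewrite ler_nat.
  exact: gdist_oslash.
suff main u v : edge u v -> N (h^-1 *: (g v - g u)) <= D / (1 + eta).
  move=> u v /orP[] /main; rewrite -scalerBr => //.
  by rewrite !NhZ is_norm_distC.
move=> uv; pose e : dedge H := Sub (u, v) uv.
pose w x := f (copy e x).
have ws : w (src G) = g u by rewrite /w copy_src.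
have wt : w (tgt G) = g v by rewrite /w copy_tgt.
have wD x y : N (w x - w y) <= D * (gdist x y)%:R.
  have [p xyp <-] := gdist_walk x y cG.
  by have := stretch_walk fD (copy_walk e xyp); rewrite size_map.
set y := h^-1 *: (g v - g u).
have yD : N y <= D.
  by rewrite NhZ ler_pdivrMr// is_norm_distC// -ws -wt; apply: wD.
(* The deviation of [w x], rescaled, from the point dividing the segment from [g u] to [g v] as [k]
   to [h - k]. As [N y <= D], adding the rest of the segment bounds both [y + z x] and [y - z x] by
   [D], so the level need not be the middle one. *)
pose z x := h^-1 *: (w x - g u) - (k / h) *: y.
have D0 : 0 <= D by apply: le_trans yD; apply: is_norm_ge0.
rewrite ler_pdivlMr//.
have kh01 : 0 <= k / h by rewrite divr_ge0 ?ltW.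
have kh1 : 0 <= 1 - k / h by rewrite subr_ge0 ler_pdivrMr// mul1r ltW.
apply: (amuc_spread (X := [set x : G | gdist (src G) x = j]) (v := z)
  (r := h^-1) normN eqN t01 eta0 lt_eta jinf); rewrite ?invr_gt0//.
- move=> x /= xj.
  have -> : y + z x = h^-1 *: (w x - g u) + (1 - k / h) *: y.
    by rewrite scalerBl scale1r addrCA.
  apply: le_trans (ND _ _) _; rewrite NhZ NZ ger0_norm//.
  have := wD (src G) x; rewrite xj ws is_norm_distC// -/k => wx.
  have -> : D = D * k / h + (1 - k / h) * D by field; rewrite gt_eqF.
  by apply: lerD; [rewrite ler_pM2r ?invr_gt0|apply: ler_wpM2l].
- move=> x /= xj.
  have -> : y - z x = h^-1 *: (g v - w x) + (k / h) *: y.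
    rewrite /z opprB addrA addrAC; congr (_ + _).
    by rewrite /y -scalerBr opprB addrA subrK.
  apply: le_trans (ND _ _) _; rewrite NhZ NZ ger0_norm//.
  have xt : (gdist x (tgt G))%:R = h - k.
    by rewrite /h -(Gh x) xj natrD /k addrAC subrr add0r.
  have := wD x (tgt G); rewrite xt wt is_norm_distC// => wx.
  have -> : D = D * (h - k) / h + (k / h) * D by field; rewrite gt_eqF.
  by apply: lerD; [rewrite ler_pM2r ?invr_gt0|apply: ler_wpM2l].
(* Vertices strictly between the ends have distinct copies, at distance at least 1; rescaling turns
   this separation into [h^-1]. *)
- move=> x x' xj x'j xx'.
  have -> : z x - z x' = h^-1 *: (w x - w x').
    by rewrite /z opprB addrA subrK -scalerBr opprB addrA subrK.
  rewrite NhZ; apply: ler_peMl; first by rewrite invr_ge0 ltW.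
  apply: le_trans (fD.1 _ _); rewrite ler1n lt0n.
  have cO := connected_oslash st cH cG.
  apply/eqP => /(gdist_eq0 cO) /(copy_inj _ _)xx; apply: xx'; apply: xx.
    by apply: contraTneq j0 => xs; rewrite -(xj : _ = j) xs gdistxx.
  by apply: contraTneq jh => xs; rewrite -(xj : _ = j) xs ltnn.
- by rewrite -[h^-1]mul1r ler_pdivlMr//; move: tD; rewrite -/h; lra.
Qed.

End stretch.

Lemma powRV {R : realType} (x p : R) : 0 < x -> x^-1 `^ p = (x `^ p)^-1.
Proof.
by move=> x0; rewrite -[x^-1]powR_inv1 ?ltW// powRAC powR_inv1// powR_ge0.
Qed.

(** * Iterating the descent along the family *)

Section omega.
Context {R : realType} {Y : normedModType R}.
Variables (N : Y -> R) (G : nat -> stdigraph).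
Hypotheses (eqN : equivalent_norm N) (omegaG : omega_family G).

Let h : R := (height (G 1%N))%:R.

Lemma omega_connected k :
  connected_graph (G k.+1) /\ src (G k.+1) != tgt (G k.+1).
Proof.
have [bG Ginf GS] := omegaG.
have [j /andP[j0 jh] _] := infinite_level bG Ginf.
have st : src (G 1%N) != tgt (G 1%N).
  by apply: contraTneq jh => st; rewrite /height -st gdistxx -leqNgt.
have [_ cG _ _] := bG.
elim: k => [//|k [IHc IHst]]; rewrite GS//; split.
  exact: connected_oslash.
by apply: contra_neq IHst => -[].
Qed.

Lemma omega_height_ge1 : 1 <= h.
Proof.
have [bG Ginf _] := omegaG; have [j /andP[_ jh] _] := infinite_level bG Ginf.
by rewrite ler1n (leq_ltn_trans _ jh).
Qed.

Lemma omega_stretch_ge1 k (f : G k.+1 -> Y) (D : R) : stretch N f D -> 1 <= D.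
Proof. by have [cG st] := omega_connected k; apply: stretch_ge1. Qed.

Lemma omega_stretchS k (f : G k.+2 -> Y) (D t eta : R) :
    0 < t < 1 -> 0 <= eta -> (eta%:E < amuc_modulus N t)%E ->
    t * (4%:R * h * D) <= 1 -> stretch N f D ->
  exists f' : G k.+1 -> Y, stretch N f' (D / (1 + eta)).
Proof.
have [bG Ginf GS] := omegaG; have [cG _] := omega_connected k.
move: f; rewrite GS// => f t01 eta0 lt_eta tD.
exact: stretch_oslash t01 _ _ _.
Qed.

(** The constant only decreases during the descent, so one [t] fitted to [M], and one [eta], serve
    every step. The bound is Bernoulli's inequality for repeated division by [1 + eta]. *)
Lemma omega_stretch_linear (M t eta : R) :
    0 < t < 1 -> 0 <= eta -> (eta%:E < amuc_modulus N t)%E ->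
    t * (4%:R * h * M) <= 1 ->
  forall k (f : G k.+1 -> Y) (D : R), D <= M -> stretch N f D ->
    1 + eta * k%:R <= D.
Proof.
move=> t01 eta0 lt_eta tM; have h1 := omega_height_ge1.
elim=> [|k IHk] f D DM fD; have D1 := omega_stretch_ge1 fD.
  by rewrite mulr0 addr0.
have [|f' f'D] := omega_stretchS t01 eta0 lt_eta _ fD.
  apply: le_trans tM; move: t01 => /andP[t0 _].
  by rewrite ler_pM2l// ler_pM2l// mulr_gt0//; lra.
have eta1 : 0 < 1 + eta by lra.
have /IHk/(_ f'D) : D / (1 + eta) <= M.
  by apply: le_trans DM; rewrite ler_pdivrMr//; nra.
rewrite ler_pdivlMr// => DS; apply: le_trans DS.
rewrite -natr1; have : 0 <= eta * (eta * k%:R) by rewrite !mulr_ge0.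
lra.
Qed.

(** Now [t] is refitted to the current [D], so the gain [eta] is of order [D ^ -p], and each step
    lowers [D ^ p] by at least the fixed amount [a / (1 + a)]. *)
Lemma omega_stretch_power (p : R) : 1 < p -> amuc_power_type N p ->
  exists2 c : R, 0 < c & forall k (f : G k.+1 -> Y) (D : R), stretch N f D ->
    c * k.+1%:R <= D `^ p.
Proof.
move=> p1 [gamma gamma0 gammaP]; have h1 := omega_height_ge1.
have p0 : 0 <= p by lra.
(* Half of [gamma] makes [eta] strictly smaller than the modulus at [t]. *)
pose a := gamma / 2%:R * (4%:R * h)^-1 `^ p.
have h4 : 0 < 4%:R * h by lra.
have a0 : 0 < a by rewrite mulr_gt0 ?divr_gt0// powR_gt0// invr_gt0.
have a1 : 0 < 1 + a by lra.
exists (a / (1 + a)); first by rewrite divr_gt0.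
elim=> [|k IHk] f D fD; have D1 := omega_stretch_ge1 fD;
    have D0 : 0 < D by [lra]; have DD := le1r_powR D1 (ltW p1).
  rewrite mulr1; apply: le_trans (le_trans D1 DD).
  by rewrite ler_pdivrMr//; lra.
set A := D `^ p in DD *; have A1 : 1 <= A by lra.
have A0 : 0 < A by lra.
pose t := (4%:R * h * D)^-1; pose eta := a / A.
have hD0 : 0 < 4%:R * h * D by rewrite mulr_gt0.
have t01 : 0 < t < 1.
  rewrite invr_gt0 hD0 invf_lt1//.
  apply: lt_le_trans (_ : 4%:R * h <= _); first by lra.
  by apply: ler_peMr; rewrite ?(ltW h4).
have eta0 : 0 < eta by rewrite divr_gt0.
have tp : t `^ p = (4%:R * h)^-1 `^ p / A.
  by rewrite /t invfM powRM ?invr_ge0 ?ltW// [D^-1 `^ p]powRV.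
have lt_eta : (eta%:E < amuc_modulus N t)%E.
  apply: lt_le_trans (gammaP _ t01); rewrite lte_fin tp [ltRHS]mulrA.
  rewrite ltr_pM2r ?invr_gt0//.
  by rewrite ltr_pM2r ?powR_gt0 ?invr_gt0//; lra.
have [|f' /IHk] := omega_stretchS t01 (ltW eta0) lt_eta _ fD.
  by rewrite mulVf// gt_eqF.
have eta1 : 1 <= 1 + eta by lra.
rewrite powRM; [|lra|by rewrite invr_ge0; lra].
rewrite -/A powRV; last by lra.
have := le1r_powR eta1 (ltW p1).
set b := (1 + eta) `^ p => etab Ab.
have Ab' : A / b <= A / (1 + eta).
  by rewrite ler_pM2l// lef_pV2 ?posrE//; lra.
have -> : a / (1 + a) * k.+2%:R = a / (1 + a) * k.+1%:R + a / (1 + a).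
  by rewrite -[k.+2%:R]natr1 mulrDr mulr1.
(* The loss in [A] from division by [1 + eta]; since [1 <= A], the factor [A / (A + a)] is at least
   [1 / (1 + a)]. *)
have -> : A = A / (1 + eta) + a * (A / (A + a)).
  by rewrite /eta; field; rewrite !gt_eqF//; lra.
apply: lerD; first exact: le_trans Ab Ab'.
rewrite ler_pM2l// ler_pdivlMr; last by lra.
rewrite mulrC ler_pdivrMr// mulrDr mulr1 lerD2l.
by apply: ler_peMl; rewrite ?(ltW a0).
Qed.

End omega.

(** * From normalised embeddings to distortion *)

(** Dividing an embedding by [A * s] makes its lower constant 1 in the norm [N]; the change of norm
    costs the factor [K = B / A]. *)
Lemma distortion_stretch {R : realType} {Y : normedModType R} (N : Y -> R) :
  equivalent_norm N ->
  exists2 K : R, 0 < K & forall (G : stdigraph) (x : \bar R),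
    (forall (f : G -> Y) (D : R), stretch N f (K * D) -> (x <= D%:E)%E) ->
    (x <= graph_distortion Y G)%E.
Proof.
move=> [[_ NZ _] [A [B [A0 B0 NAB]]]]; exists (B / A).
  by rewrite divr_gt0.
move=> G x xD; apply: le_ereal_inf_tmp => _ [D [D1 [s [f [s0 fD]]]] <-].
have As : 0 < A * s by rewrite mulr_gt0.
apply: (xD (fun u => (A * s)^-1 *: f u)); split=> u v.
  rewrite -scalerBr NZ gtr0_norm ?invr_gt0// mulrC ler_pdivlMr// mulrC -mulrA.
  have /andP[Af _] := NAB (f u - f v); apply: le_trans Af.
  by rewrite ler_pM2l//; have /andP[] := fD u v.
move=> uv; have d1 : (gdist u v <= 1)%N.
  by apply: (@gdist_le _ _ _ [:: v]); split=> //=; rewrite uv.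
rewrite -scalerBr NZ gtr0_norm ?invr_gt0// mulrC ler_pdivrMr//.
have /andP[_ /le_trans] := NAB (f u - f v); apply.
have -> : B / A * D * (A * s) = B * (D * s) by field; rewrite gt_eqF.
rewrite ler_pM2l//; have /andP[_ /le_trans] := fD u v; apply.
rewrite -[leRHS]mulr1; apply: ler_wpM2l; last by rewrite lern1.
by rewrite mulr_ge0 ?(ltW s0)//; lra.
Qed.

Theorem theorem4p1 (R : realType) (G : nat -> stdigraph)
    (Y : completeNormedModType R) :
  omega_family G ->
  ((exists N : Y -> R, equivalent_norm N /\ amuc N) ->
    ereal_sup [set graph_distortion Y (G k) | k in [set k | (1 <= k)%N]]
      = +oo%E)
  /\
  (forall (N : Y -> R) (p : R), equivalent_norm N -> amuc N -> 1 < p ->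
    amuc_power_type N p ->
    exists2 C : R, 0 < C & forall k : nat, (1 <= k)%N ->
      ((C * k%:R `^ p^-1)%:E <= graph_distortion Y (G k))%E).
Proof.
move=> omegaG; split=> [[N [eqN amN]]|N p eqN _ p1 /omega_stretch_power].
  have [K K0 KP] := distortion_stretch eqN.
  apply: eq_infty => M0; pose M := K * Num.max M0 1.
  have M1 : 0 < M by rewrite mulr_gt0// lt_max ltr01 orbT.
  pose h : R := (height (G 1%N))%:R.
  have h1 : 1 <= h by apply: omega_height_ge1.
  have hM : 0 < 4%:R * h * M.
    by rewrite mulr_gt0// mulr_gt0// (lt_le_trans ltr01).
  (* The summand 1 keeps [t] below 1. *)
  pose t := (1 + 4%:R * h * M)^-1.
  have t01 : 0 < t < 1 by apply/andP; rewrite invr_gt0 invf_lt1; lra.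
  have tM : t * (4%:R * h * M) <= 1.
    by rewrite /t mulrC ler_pdivrMr ?mul1r ?lerDr // addr_gt0.
  (* The modulus is an extended real and may be infinite, as for the zero space; then any [eta] will
     do. *)
  have [eta eta0 lt_eta] : exists2 eta : R, 0 < eta &
      (eta%:E < amuc_modulus N t)%E.
    have := amN _ t01; case: (amuc_modulus N t) => [r| |]//.
      by rewrite lte_fin => r0; exists (r / 2%:R); rewrite ?lte_fin; lra.
    by move=> _; exists 1; rewrite ?ltry.
  (* For this [k] the linear bound exceeds [M], so no embedding of [G k.+1] has constant at most
     [M]. *)
  pose k := Num.bound (M / eta).
  have Mk : M < eta * k%:R.
    by rewrite mulrC -ltr_pdivrMr// archi_boundP// divr_ge0 ?ltW.
  apply: (@le_trans _ _ (graph_distortion Y (G k.+1))); last first.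
    by apply: ereal_sup_ubound; exists k.+1.
  apply: KP => f D fD; rewrite lee_fin leNgt; apply/negP => DM0.
  have DM : K * D <= M.
    by rewrite ler_pM2l// le_max (ltW DM0).
  have := omega_stretch_linear eqN omegaG t01 (ltW eta0) lt_eta tM DM fD.
  by lra.
move=> /(_ G eqN omegaG p1)[c c0 cP].
have [K K0 KP] := distortion_stretch eqN.
have p0 : 0 < p by lra.
exists (c `^ p^-1 / K); first by rewrite divr_gt0 ?powR_gt0.
case=> // k _; apply: KP => f D fD; rewrite lee_fin mulrAC ler_pdivrMr//.
have KD : 0 <= K * D by have := omega_stretch_ge1 eqN omegaG fD; lra.
rewrite -powRM ?(ltW c0)// [D * K]mulrC.
have -> : K * D = ((K * D) `^ p) `^ p^-1.
  by rewrite -powRrM mulfV ?lt0r_neq0// powRr1.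
apply: ge0_ler_powR; last exact: cP fD.
- by rewrite invr_ge0 ltW.
- by rewrite nnegrE mulr_ge0// ltW.
- by rewrite nnegrE powR_ge0.
Qed.
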